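(* Define, for $\lambda>0$, $$\Phi(\lambda)=\sum_{p\ \mathrm{prime}}\frac{\lambda^p}{p!},\qquad Q(\lambda)=e^{-\lambda}\Phi(\lambda),\qquad c(\lambda)=\frac{\lambda}{Q(\lambda)}.$$ Then $c(\lambda)$ has a unique global minimizer $\lambda_\ast$ on $(0,\infty)$, and $$\lambda_\ast\approx 1.408509.$$ At this point, $$\rho_\ast=Q(\lambda_\ast)\approx 0.368241,\qquad c_\ast=c(\lambda_\ast)\approx 3.824963.$$ Equivalently, $c_\ast$ is the global threshold for the existence of a positive solution of the mean-field fixed-point equation $\rho=Q(c\rho)$: for $c>0$, there exists $\rho>0$ with $\rho=Q(c\rho)$ if and only if $c\ge c_\ast$.
   Context: The symbol $\approx$ means agreement after rounding to the displayed number of decimal places. The sum defining $\Phi$ runs over all prime numbers $p$. *)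

(* Defs.v *)
(* Vanilla Stdlib reals with Coquelicot. *)
From Stdlib Require Import Reals ZArith Znumtheory.
From Coquelicot Require Import Coquelicot.

Local Open Scope R_scope.

Definition prime_term (x : R) (p : nat) : R :=
  if prime_dec (Z.of_nat p) then x ^ p / INR (fact p) else 0.

Definition Phi (x : R) : R := Series (prime_term x).

Definition Qfun (x : R) : R := exp (- x) * Phi x.

Definition cfun (x : R) : R := x / Qfun x.

Definition global_minimizer_on (D : R -> Prop) (f : R -> R) (x : R) : Prop :=
  D x /\ forall y : R, D y -> f x <= f y.

(* [Int_part] is the floor, so this is rounding to the nearest multiple of
   10^-k, with ties rounded up. *)
Definition round_decimals (k : nat) (x : R) : R :=
  IZR (Int_part (x * 10 ^ k + / 2)) / 10 ^ k.

(* [x] agrees with the [k]-decimal number [d] after rounding. *)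
Definition approx_decimals (k : nat) (x d : R) : Prop :=
  round_decimals k x = d.

(* Main.v *)
Require Import Defs.
From Stdlib Require Import Reals ZArith Znumtheory Lra Lia.
From Coquelicot Require Import Coquelicot.
Local Open Scope R_scope.

(** Write Phi(x) = x Psi(x). Then Q(x) = exp(-x) x Psi(x), so c = exp / Psi and
    c' = exp (Psi - Psi') / Psi^2: the sign of c' is that of Psi - Psi', called
    [slope] below.

    The difference Psi - Psi' is strictly increasing on [0, 4]. Its derivative
    has the prime expansion sum_p (p-1) x^(p-3) (x - (p-2)) / p!, in which the
    terms for p = 2, 3, 5, 7 already outweigh the possible negative
    contributions of the larger primes ([slope_deriv_pos]). Evaluation of the
    truncated series at two points 10^-8 apart shows that Psi - Psi' has a zero
    l between them ([slope_root]). Hence c decreases strictly up to l and increases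
    strictly from l to 4. Beyond 4 nothing has to be computed, because Q is a
    probability, so c(x) = x / Q(x) >= x > 4 ([cfun_ge_id]) while c(l) < 3.83.
    Therefore l is the only global minimizer.

    For the decimals, all the series involved (exp, Psi, Psi - Psi' and its
    derivative) have coefficients at most 1/n! in absolute value, so one
    remainder estimate serves them all ([exp_dominated_remainder]).

    For the threshold, put x = c rho: the equation rho = Q(c rho) says exactly
    that c(x) = c. So a solution forces c >= c(l), and conversely the value c is
    attained on [l, c] by the intermediate value theorem, since c(x) >= x
    ([cfun_surjective_above]). *)

(** * Power series with coefficients dominated by those of the exponential *)

Definition exp_dominated (u : nat -> R) : Prop :=
  forall n : nat, Rabs (u n) <= / INR (fact n).

Lemma inv_fact_pos (n : nat) : 0 < / INR (fact n).
Proof. apply Rinv_0_lt_compat, INR_fact_lt_0. Qed.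

Lemma inv_fact_S (n : nat) : INR (S n) * / INR (fact (S n)) = / INR (fact n).
Proof.
  rewrite fact_simpl, mult_INR. field.
  split; [apply INR_fact_neq_0 | apply not_0_INR; lia].
Qed.

Lemma inv_fact_S_le (n : nat) : / INR (fact (S n)) <= / INR (fact n).
Proof.
  rewrite <- (inv_fact_S n). rewrite <- (Rmult_1_l (/ INR (fact (S n)))) at 1.
  apply Rmult_le_compat_r; [left; apply inv_fact_pos |].
  rewrite S_INR. generalize (pos_INR n). lra.
Qed.

(** A binomial coefficient is at least one, which is what lets a tail of the
    exponential series factor through its first term. *)
Lemma inv_fact_add_le (m n : nat) :
  / INR (fact (m + n)) <= / INR (fact m) * / INR (fact n).
Proof.
  rewrite <- Rinv_mult, <- mult_INR.
  apply Rinv_le_contravar.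
  - rewrite mult_INR. apply Rmult_lt_0_compat; apply INR_fact_lt_0.
  - apply le_INR. induction m as [|m IH]; [simpl; lia |].
    change (S m + n)%nat with (S (m + n)). rewrite !fact_simpl. nia.
Qed.

Lemma is_series_exp (x : R) : is_series (fun n => / INR (fact n) * x ^ n) (exp x).
Proof.
  generalize (is_exp_Reals x). apply is_series_ext. intros n.
  rewrite pow_n_pow. apply Rmult_comm.
Qed.

Lemma ex_series_exp_dominated (u : nat -> R) (x : R) :
  exp_dominated u -> ex_series (fun n => Rabs (u n * x ^ n)).
Proof.
  intros Hu.
  apply (@ex_series_le R_AbsRing R_CompleteNormedModule)
    with (b := fun n => / INR (fact n) * Rabs x ^ n).
  - intros n. change norm with Rabs. cbv beta. rewrite Rabs_Rabsolu, Rabs_mult, RPow_abs.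
    apply Rmult_le_compat_r; [apply Rabs_pos | apply Hu].
  - eexists; apply is_series_exp.
Qed.

(** The terms u_n x^n tend to zero at every x, which rules out a finite radius. *)
Lemma exp_dominated_radius (u : nat -> R) (x : R) :
  exp_dominated u -> Rbar_lt (Rabs x) (CV_radius u).
Proof.
  intros Hu. apply Rbar_not_le_lt. intros Hle.
  apply (CV_disk_outside u (Rabs x + 1)).
  - apply Rbar_le_lt_trans with (1 := Hle). simpl.
    apply Rlt_le_trans with (2 := Rle_abs _). lra.
  - apply ex_series_lim_0, ex_series_Rabs, ex_series_exp_dominated, Hu.
Qed.

Lemma exp_dominated_ex_pseries (u : nat -> R) (x : R) :
  exp_dominated u -> ex_pseries u x.
Proof. intros Hu. apply CV_radius_inside, exp_dominated_radius, Hu. Qed.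

Lemma exp_dominated_continuity (u : nat -> R) :
  exp_dominated u -> continuity (PSeries u).
Proof. intros Hu x. apply PSeries_continuity, exp_dominated_radius, Hu. Qed.

Lemma exp_dominated_is_derive (u : nat -> R) (x : R) :
  exp_dominated u -> is_derive (PSeries u) x (PSeries (PS_derive u) x).
Proof. intros Hu. apply is_derive_PSeries, exp_dominated_radius, Hu. Qed.

(** The exponential series is its own derivative, so domination passes to
    derivatives. *)
Lemma exp_dominated_derive (u : nat -> R) :
  exp_dominated u -> exp_dominated (PS_derive u).
Proof.
  intros Hu n. unfold PS_derive.
  rewrite Rabs_mult, (Rabs_pos_eq (INR (S n))) by apply pos_INR.
  rewrite <- inv_fact_S. apply Rmult_le_compat_l; [apply pos_INR | apply Hu].
Qed.

Lemma exp_dominated_inv_fact : exp_dominated (fun n => / INR (fact n)).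
Proof. intros n. rewrite Rabs_pos_eq; [lra | left; apply inv_fact_pos]. Qed.

Lemma PSeries_inv_fact (x : R) : PSeries (fun n => / INR (fact n)) x = exp x.
Proof. apply is_series_unique, is_series_exp. Qed.

Lemma exp_dominated_PSeries_le (u : nat -> R) (x C : R) :
  0 <= x -> (forall n, Rabs (u n) <= C * / INR (fact n)) ->
  Rabs (PSeries u x) <= C * exp x.
Proof.
  intros Hx Hu.
  assert (HE : is_series (fun n => C * (/ INR (fact n) * x ^ n)) (C * exp x))
    by exact (is_series_scal (V := R_NormedModule) C _ _ (is_series_exp x)).
  assert (Hb : forall n, 0 <= Rabs (u n * x ^ n) <= C * (/ INR (fact n) * x ^ n)).
  { intros n. split; [apply Rabs_pos |].
    rewrite Rabs_mult, (Rabs_pos_eq (x ^ n)) by (apply pow_le, Hx).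
    rewrite <- Rmult_assoc. apply Rmult_le_compat_r; [apply pow_le, Hx | apply Hu]. }
  rewrite <- (is_series_unique _ _ HE). unfold PSeries.
  eapply Rle_trans; [apply Series_Rabs |].
  - apply (@ex_series_le R_AbsRing R_CompleteNormedModule)
      with (b := fun n => C * (/ INR (fact n) * x ^ n)); [| eexists; exact HE].
    intros n. change norm with Rabs. cbv beta. rewrite Rabs_Rabsolu. apply Hb.
  - apply Series_le; [exact Hb | eexists; exact HE].
Qed.

(** A Lagrange-type remainder bound; all the numerical estimates below come
    from it. *)
Lemma exp_dominated_remainder (u : nat -> R) (x : R) (n : nat) :
  exp_dominated u -> 0 <= x ->
  Rabs (PSeries u x - sum_f_R0 (fun k => u k * x ^ k) n)
    <= x ^ S n * / INR (fact (S n)) * exp x.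
Proof.
  intros Hu Hx.
  rewrite (PSeries_decr_n u n x) by (apply exp_dominated_ex_pseries, Hu).
  match goal with |- Rabs ?e <= _ =>
    replace e with (x ^ S n * PSeries (PS_decr_n u (S n)) x) by ring end.
  rewrite Rabs_mult, (Rabs_pos_eq (x ^ S n)) by (apply pow_le, Hx).
  rewrite Rmult_assoc. apply Rmult_le_compat_l; [apply pow_le, Hx |].
  apply exp_dominated_PSeries_le; [exact Hx |].
  intros k. unfold PS_decr_n.
  eapply Rle_trans; [apply Hu | apply inv_fact_add_le].
Qed.

(** * The function Psi = Phi / id and the sign of the derivative of c *)

Definition prime_coeff (p : nat) : R :=
  if prime_dec (Z.of_nat p) then / INR (fact p) else 0.

Definition psi_coeff : nat -> R := PS_decr_1 prime_coeff.

Definition Psi : R -> R := PSeries psi_coeff.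

(** The coefficients of Psi - Psi', whose sign is that of the derivative of c. *)
Definition slope_coeff : nat -> R := PS_minus psi_coeff (PS_derive psi_coeff).

Definition slope : R -> R := PSeries slope_coeff.

Lemma prime_coeff_bounds (n : nat) : 0 <= prime_coeff n <= / INR (fact n).
Proof.
  unfold prime_coeff. generalize (inv_fact_pos n).
  destruct prime_dec; lra.
Qed.

Lemma psi_coeff_bounds (n : nat) : 0 <= psi_coeff n <= / INR (fact n).
Proof.
  unfold psi_coeff, PS_decr_1.
  generalize (prime_coeff_bounds (S n)) (inv_fact_S_le n). lra.
Qed.

Lemma psi_coeff_dominated : exp_dominated psi_coeff.
Proof. intros n. rewrite Rabs_pos_eq; apply psi_coeff_bounds. Qed.

(** Subtracting two sequences with values in the same interval [0, 1/n!]
    keeps the bound. *)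
Lemma slope_coeff_dominated : exp_dominated slope_coeff.
Proof.
  intros n. unfold slope_coeff, PS_minus. change plus with Rplus. change opp with Ropp.
  assert (H1 := psi_coeff_bounds n).
  assert (H2 := exp_dominated_derive _ psi_coeff_dominated n).
  assert (H3 : 0 <= PS_derive psi_coeff n).
  { apply Rmult_le_pos; [apply pos_INR | apply psi_coeff_bounds]. }
  rewrite Rabs_pos_eq in H2 by exact H3. apply Rabs_le. lra.
Qed.

Lemma Phi_Psi (x : R) : Phi x = x * Psi x.
Proof.
  unfold Phi.
  transitivity (PSeries prime_coeff x).
  - apply Series_ext. intros n. unfold prime_term, prime_coeff.
    destruct prime_dec; unfold Rdiv; ring.
  - rewrite PSeries_decr_1.
    + unfold prime_coeff at 1. destruct prime_dec as [H|H].
      * exfalso. apply not_prime_0, H.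
      * unfold Psi, psi_coeff. ring.
    + apply exp_dominated_ex_pseries. intros n.
      rewrite Rabs_pos_eq; apply prime_coeff_bounds.
Qed.

Lemma slope_eq (x : R) : slope x = Psi x - PSeries (PS_derive psi_coeff) x.
Proof.
  unfold slope, slope_coeff. rewrite PSeries_minus; [reflexivity | |];
    apply exp_dominated_ex_pseries; [| apply exp_dominated_derive];
    apply psi_coeff_dominated.
Qed.

Lemma Psi_pos (x : R) : 0 < x -> 0 < Psi x.
Proof.
  intros Hx.
  assert (H2 : psi_coeff 1 = / 2).
  { unfold psi_coeff, PS_decr_1, prime_coeff.
    destruct prime_dec as [H|H]; [simpl; lra | exfalso; apply H, prime_2]. }
  assert (H0 := proj1 (psi_coeff_bounds 0)).
  unfold Psi. rewrite (PSeries_decr_n _ 1) by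
    (apply exp_dominated_ex_pseries, psi_coeff_dominated).
  assert (HT : 0 <= PSeries (PS_decr_n psi_coeff 2) x).
  { unfold PSeries. match goal with |- 0 <= Series ?t =>
      rewrite <- (Rmult_0_l (Series t)), <- Series_scal_l end.
    apply Series_le.
    - intros n. rewrite Rmult_0_l. split; [lra |]. apply Rmult_le_pos;
        [apply psi_coeff_bounds | apply pow_le; lra].
    - apply ex_series_Rabs, ex_series_exp_dominated. intros n.
      unfold PS_decr_n. rewrite Rabs_pos_eq by apply psi_coeff_bounds.
      eapply Rle_trans; [apply psi_coeff_bounds |].
      change (2 + n)%nat with (S (S n)).
      eapply Rle_trans; apply inv_fact_S_le. }
  cbn [sum_f_R0]. rewrite H2, pow_O, pow_1.
  assert (0 <= x ^ 2 * PSeries (PS_decr_n psi_coeff 2) x)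
    by (apply Rmult_le_pos; [apply pow_le; lra | exact HT]).
  lra.
Qed.

(** Q is a probability: the primes carry at most the whole Poisson mass. *)
Lemma Phi_le_exp (x : R) : 0 <= x -> Phi x <= exp x.
Proof.
  intros Hx. rewrite <- (is_series_unique _ _ (is_series_exp x)). unfold Phi.
  apply Series_le; [| eexists; apply is_series_exp].
  intros n. unfold prime_term.
  assert (H : 0 <= / INR (fact n) * x ^ n)
    by (apply Rmult_le_pos; [left; apply inv_fact_pos | apply pow_le, Hx]).
  destruct prime_dec; unfold Rdiv; lra.
Qed.

Lemma Qfun_pos (x : R) : 0 < x -> 0 < Qfun x.
Proof.
  intros Hx. unfold Qfun. rewrite Phi_Psi.
  apply Rmult_lt_0_compat; [apply exp_pos |].
  apply Rmult_lt_0_compat; [exact Hx | apply Psi_pos, Hx].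
Qed.

Lemma cfun_eq (x : R) : 0 < x -> cfun x = exp x / Psi x.
Proof.
  intros Hx. unfold cfun, Qfun. rewrite Phi_Psi, exp_Ropp. field.
  assert (H1 := exp_pos x). assert (H2 := Psi_pos x Hx). repeat split; lra.
Qed.

Lemma cfun_ge_id (x : R) : 0 < x -> x <= cfun x.
Proof.
  intros Hx. rewrite cfun_eq by exact Hx. apply Rle_div_r; [apply Psi_pos, Hx |].
  rewrite <- Phi_Psi. apply Phi_le_exp. lra.
Qed.

Lemma is_derive_exp_div_Psi (x : R) :
  0 < x -> is_derive (fun t => exp t / Psi t) x (exp x * slope x / Psi x ^ 2).
Proof.
  intros Hx. assert (HP := Psi_pos x Hx).
  rewrite slope_eq.
  evar_last.
  - apply is_derive_div; [apply is_derive_exp | | lra].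
    apply exp_dominated_is_derive, psi_coeff_dominated.
  - change mult with Rmult. fold Psi. field. lra.
Qed.

(** * Numerical evaluation of the truncated series *)

(** Trial division, so that the primality of the small indices is decided by
    computation. *)
Definition primeb (n : nat) : bool :=
  (1 <? Z.of_nat n)%Z &&
  List.forallb (fun d => negb (Z.of_nat n mod Z.of_nat d =? 0)%Z)
    (List.seq 2 (n - 2)).

Lemma primeb_spec (n : nat) : primeb n = true <-> prime (Z.of_nat n).
Proof.
  unfold primeb. rewrite Bool.andb_true_iff, Z.ltb_lt, List.forallb_forall.
  rewrite <- prime_alt. unfold prime'.
  split; intros [Hn H]; (split; [exact Hn |]).
  - intros d Hd Hdiv.
    specialize (H (Z.to_nat d)). rewrite Z2Nat.id in H by lia.
    rewrite (proj2 (Z.mod_divide (Z.of_nat n) d ltac:(lia)) Hdiv) in H.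
    discriminate H. apply List.in_seq. lia.
  - intros d Hd. apply List.in_seq in Hd.
    apply Bool.negb_true_iff, Z.eqb_neq. intros Hmod.
    apply (H (Z.of_nat d)); [lia |]. apply Z.mod_divide; [lia | exact Hmod].
Qed.

(** Factorials in binary: the unary ones are too large to be computed. *)
Fixpoint Zfact (n : nat) : Z :=
  match n with O => 1 | S m => Z.of_nat n * Zfact m end%Z.

Lemma INR_fact_Zfact (n : nat) : INR (fact n) = IZR (Zfact n).
Proof.
  rewrite INR_IZR_INZ. f_equal. induction n as [|n IH]; [reflexivity |].
  rewrite fact_simpl, Nat2Z.inj_mul, IH. reflexivity.
Qed.

Lemma prime_coeff_value (n : nat) :
  prime_coeff n = if primeb n then / IZR (Zfact n) else 0.
Proof.
  unfold prime_coeff. rewrite INR_fact_Zfact. generalize (primeb_spec n).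
  destruct prime_dec, (primeb n); intuition congruence.
Qed.

Ltac eval_coeffs :=
  rewrite ?prime_coeff_value, ?INR_IZR_INZ;
  repeat match goal with
  | |- context [primeb ?n] =>
      let b := eval vm_compute in (primeb n) in change (primeb n) with b
  | |- context [Zfact ?n] =>
      let z := eval vm_compute in (Zfact n) in change (Zfact n) with z
  | |- context [Z.of_nat ?n] =>
      let z := eval vm_compute in (Z.of_nat n) in change (Z.of_nat n) with z
  end; cbv iota.

(** The truncations keep the powers below x^16, so a prime p leaves its term
    x^(p-1) / p! only for p <= 13, while its derivative also survives for p = 17. *)
Definition Psi_poly (x : R) : R :=
  x / 2 + x ^ 2 / 6 + x ^ 4 / 120 + x ^ 6 / 5040
  + x ^ 10 / 39916800 + x ^ 12 / 6227020800.

Definition slope_poly (x : R) : R :=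
  Psi_poly x
  - (1 / 2 + 2 * x / 6 + 4 * x ^ 3 / 120 + 6 * x ^ 5 / 5040
     + 10 * x ^ 9 / 39916800 + 12 * x ^ 11 / 6227020800
     + 16 * x ^ 15 / 355687428096000).

(** Each prime p contributes (p-1) x^(p-3) (x - (p-2)) / p!, the derivative of
    (x^(p-1) - (p-1) x^(p-2)) / p!. *)
Definition slope'_poly (x : R) : R :=
  1 / 2 + 2 * (x - 1) / 6 + 4 * x ^ 2 * (x - 3) / 120
  + 6 * x ^ 4 * (x - 5) / 5040 + 10 * x ^ 8 * (x - 9) / 39916800
  + 12 * x ^ 10 * (x - 11) / 6227020800
  + 16 * x ^ 14 * (x - 15) / 355687428096000.

Lemma Psi_partial_sum (x : R) :
  sum_f_R0 (fun k => psi_coeff k * x ^ k) 15 = Psi_poly x.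
Proof.
  cbn [sum_f_R0]. unfold psi_coeff, PS_decr_1. eval_coeffs.
  unfold Psi_poly. field.
Qed.

Lemma slope_partial_sum (x : R) :
  sum_f_R0 (fun k => slope_coeff k * x ^ k) 15 = slope_poly x.
Proof.
  cbn [sum_f_R0].
  unfold slope_coeff, PS_minus, PS_derive, psi_coeff, PS_decr_1.
  change plus with Rplus. change opp with Ropp. eval_coeffs.
  unfold slope_poly, Psi_poly. field.
Qed.

Lemma slope'_partial_sum (x : R) :
  sum_f_R0 (fun k => PS_derive slope_coeff k * x ^ k) 15 = slope'_poly x.
Proof.
  cbn [sum_f_R0].
  unfold slope_coeff, PS_minus, PS_derive, psi_coeff, PS_decr_1.
  change plus with Rplus. change opp with Ropp. eval_coeffs.
  unfold slope'_poly. field.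
Qed.

Definition exp_poly (x : R) : R :=
  sum_f_R0 (fun k => / IZR (Zfact k) * x ^ k) 15.

Lemma exp_le_pow3 (n : nat) (x : R) : x <= INR n -> exp x <= 3 ^ n.
Proof.
  intros Hx. apply Rle_trans with (exp (INR n)).
  - destruct (Rle_lt_or_eq_dec _ _ Hx) as [H | H];
      [left; apply exp_increasing, H | rewrite H; lra].
  - clear. induction n as [|n IH]; [simpl; rewrite exp_0; lra |].
    rewrite S_INR, exp_plus. simpl pow. generalize exp_le_3 (exp_pos (INR n)). nra.
Qed.

(** The minimizer is 1.4085087234. Its enclosure is a hundred times finer than
    the displayed precision because exp and Psi are bounded separately on it, so
    the width of the enclosure is multiplied by about c in the bounds for c. *)
Definition lam_lo : R := 1.40850872.
Definition lam_hi : R := 1.40850873.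

(** The slope of Psi - Psi' near its zero is about 1/2, so at the two ends of the
    enclosure Psi - Psi' is about -1.7e-9 and 3.4e-9: an error below 1e-9 leaves
    both signs certain. *)
Lemma remainder_below_hi (u : nat -> R) (x : R) :
  exp_dominated u -> 0 <= x <= lam_hi ->
  Rabs (PSeries u x - sum_f_R0 (fun k => u k * x ^ k) 15) <= / 10 ^ 9.
Proof.
  intros Hu Hx.
  eapply Rle_trans; [apply exp_dominated_remainder; [exact Hu | lra] |].
  assert (HE : exp x <= 3 ^ 2) by (apply exp_le_pow3; unfold lam_hi in Hx; simpl; lra).
  rewrite INR_fact_Zfact. eval_coeffs.
  assert (0 <= x ^ 16) by (apply pow_le; lra).
  assert (x ^ 16 <= 250)
    by (apply Rle_trans with (lam_hi ^ 16); [apply pow_incr, Hx | unfold lam_hi; lra]).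
  generalize (exp_pos x). intros.
  assert (x ^ 16 * exp x <= 250 * 3 ^ 2) by (apply Rmult_le_compat; lra).
  lra.
Qed.

(** The factor x - (p-2) is negative on [0, 4] when p >= 7. For p = 7 it is
    absorbed by the cubic term of p = 5; the terms of p = 11, 13, 17 are
    bounded below by small multiples of x^4, and the series from x^16 on is
    below 0.02, against the constant term 1/6. *)
Lemma slope_deriv_pos (x : R) : 0 <= x <= 4 -> 0 < PSeries (PS_derive slope_coeff) x.
Proof.
  intros Hx.
  assert (HR := exp_dominated_remainder _ x 15
    (exp_dominated_derive _ slope_coeff_dominated) (proj1 Hx)).
  rewrite slope'_partial_sum, INR_fact_Zfact in HR.
  revert HR. eval_coeffs. intros HR.
  assert (HE : exp x <= 3 ^ 4) by (apply exp_le_pow3; simpl; lra).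
  assert (HX : forall n, 0 <= x ^ n <= 4 ^ n)
    by (intros n; split; [apply pow_le | apply pow_incr]; lra).
  assert (x ^ 16 * exp x <= 4 ^ 16 * 3 ^ 4)
    by (apply Rmult_le_compat; try apply HX; [left; apply exp_pos | exact HE]).
  apply Rabs_le_between in HR.
  assert (Htail : forall n a, 0 <= a -> - (a * 4 ^ n) * x ^ 4 <= x ^ (4 + n) * (x - a)).
  { intros n a Ha. rewrite pow_add.
    assert (H4 := HX 4%nat). assert (Hn := HX n).
    assert (x ^ n * a <= 4 ^ n * a) by (apply Rmult_le_compat_r; lra).
    assert (0 <= x ^ n * x) by (apply Rmult_le_pos; lra).
    replace (x ^ 4 * x ^ n * (x - a)) with (x ^ 4 * (x ^ n * x - x ^ n * a)) by ring.
    rewrite (Rmult_comm (- _)). apply Rmult_le_compat_l; lra. }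
  assert (H11 := Htail 4%nat 9 ltac:(lra)).
  assert (H13 := Htail 6%nat 11 ltac:(lra)).
  assert (H17 := Htail 10%nat 15 ltac:(lra)).
  clear Htail. simpl Nat.add in H11, H13, H17.
  unfold slope'_poly in HR.
  (* The cubic coefficient 1/30 is split as 1/50 + 1/75: each share makes one of
     the two remaining quadratic factors positive definite; 7/10000 covers the
     multiples of x^4 found above. *)
  assert (Hlow : 0 <= x * (1 / 3 - x / 10 + x ^ 2 / 50)) by (apply Rmult_le_pos; nra).
  assert (Hhigh : 0 <= x ^ 3 * (1 / 75 - 6 * x / 1008 - 7 * x / 10000 + x ^ 2 / 840))
    by (apply Rmult_le_pos; [apply HX | nra]).
  assert (H4 := proj1 (HX 4%nat)). clear HX.
  lra.
Qed.

Lemma slope_approx (x : R) :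
  0 <= x <= lam_hi -> Rabs (slope x - slope_poly x) <= / 10 ^ 9.
Proof.
  intros Hx. unfold slope. rewrite <- slope_partial_sum.
  apply remainder_below_hi; [apply slope_coeff_dominated | exact Hx].
Qed.

Lemma slope_lo_neg : slope lam_lo < 0.
Proof.
  assert (H := slope_approx lam_lo ltac:(unfold lam_lo, lam_hi; lra)).
  assert (slope_poly lam_lo < - / 10 ^ 9)
    by (unfold slope_poly, Psi_poly, lam_lo; lra).
  apply Rabs_le_between in H. lra.
Qed.

Lemma slope_hi_pos : 0 < slope lam_hi.
Proof.
  assert (H := slope_approx lam_hi ltac:(unfold lam_hi; lra)).
  assert (/ 10 ^ 9 < slope_poly lam_hi)
    by (unfold slope_poly, Psi_poly, lam_hi; lra).
  apply Rabs_le_between in H. lra.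
Qed.

Lemma slope_root : exists l : R, lam_lo <= l <= lam_hi /\ slope l = 0.
Proof.
  assert (Hlo := slope_lo_neg). assert (Hhi := slope_hi_pos).
  assert (Hle : lam_lo <= lam_hi) by (unfold lam_lo, lam_hi; lra).
  destruct (IVT_gen slope lam_lo lam_hi 0) as [l [Hl H0]].
  - apply exp_dominated_continuity, slope_coeff_dominated.
  - rewrite Rmin_left, Rmax_right; lra.
  - rewrite Rmin_left, Rmax_right in Hl by exact Hle. exists l; tauto.
Qed.

Lemma exp_lo_bounds : 4.08985173 <= exp lam_lo <= 4.08985175.
Proof.
  assert (H : Rabs (exp lam_lo - exp_poly lam_lo) <= / 10 ^ 9).
  { rewrite <- PSeries_inv_fact. unfold exp_poly.
    rewrite <- (sum_eq (fun k => / INR (fact k) * lam_lo ^ k))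
      by (intros; rewrite INR_fact_Zfact; reflexivity).
    apply remainder_below_hi; [apply exp_dominated_inv_fact |].
    unfold lam_lo, lam_hi; lra. }
  assert (Hv : 4.089851735 <= exp_poly lam_lo <= 4.089851745).
  { unfold exp_poly, lam_lo. cbn [sum_f_R0]. eval_coeffs. lra. }
  apply Rabs_le_between in H. lra.
Qed.

Lemma Psi_approx (x : R) :
  0 <= x <= lam_hi -> Rabs (Psi x - Psi_poly x) <= / 10 ^ 9.
Proof.
  intros Hx. unfold Psi. rewrite <- Psi_partial_sum.
  apply remainder_below_hi; [apply psi_coeff_dominated | exact Hx].
Qed.

(** * The minimizer and the threshold *)

Lemma slope_increasing (x y : R) : 0 <= x -> x < y -> y <= 4 -> slope x < slope y.
Proof.
  intros Hx Hxy Hy.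
  apply (incr_function_le slope 0 4 (PSeries (PS_derive slope_coeff))); simpl; try lra.
  - intros t _ _. apply exp_dominated_is_derive, slope_coeff_dominated.
  - intros t H0 H4. apply Rlt_gt, slope_deriv_pos. lra.
Qed.

Lemma cfun_mean_value (x y : R) :
  0 < x < y ->
  exists t : R, x < t < y /\
    cfun y - cfun x = exp t * slope t / Psi t ^ 2 * (y - x).
Proof.
  intros [Hx Hxy].
  destruct (MVT_cor2 (fun t => exp t / Psi t) (fun t => exp t * slope t / Psi t ^ 2)
    x y Hxy) as [t [Ht Htxy]].
  - intros t Ht. apply is_derive_Reals, is_derive_exp_div_Psi. lra.
  - exists t. split; [exact Htxy |]. rewrite !cfun_eq by lra. exact Ht.
Qed.

(** The mean value theorem is used with an interior point, where the derivative
    has a strict sign although it vanishes at l. *)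
Lemma cfun_slope_lt (l y : R) :
  0 < l <= 4 -> slope l = 0 -> 0 < y <= 4 -> y <> l -> cfun l < cfun y.
Proof.
  intros Hl H0 Hy Hne.
  assert (Hq : forall t, 0 < t -> 0 < exp t / Psi t ^ 2)
    by (intros t Ht; apply Rdiv_lt_0_compat; [apply exp_pos | apply pow_lt, Psi_pos, Ht]).
  destruct (Rtotal_order y l) as [Hlt | [Heq | Hgt]]; [| contradiction |].
  - destruct (cfun_mean_value y l) as [t [Ht Hd]]; [lra |].
    assert (Hs : slope t < slope l) by (apply slope_increasing; lra).
    assert (Ht0 := Hq t ltac:(lra)).
    replace (exp t * slope t / Psi t ^ 2) with (exp t / Psi t ^ 2 * slope t) in Hd
      by (unfold Rdiv; ring).
    assert (0 < exp t / Psi t ^ 2 * - slope t * (l - y))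
      by (apply Rmult_lt_0_compat; [apply Rmult_lt_0_compat |]; lra).
    lra.
  - destruct (cfun_mean_value l y) as [t [Ht Hd]]; [lra |].
    assert (Hs : slope l < slope t) by (apply slope_increasing; lra).
    assert (Ht0 := Hq t ltac:(lra)).
    replace (exp t * slope t / Psi t ^ 2) with (exp t / Psi t ^ 2 * slope t) in Hd
      by (unfold Rdiv; ring).
    assert (0 < exp t / Psi t ^ 2 * slope t * (y - l))
      by (apply Rmult_lt_0_compat; [apply Rmult_lt_0_compat |]; lra).
    lra.
Qed.

Lemma cfun_lo_le : cfun lam_lo <= 3.8249632.
Proof.
  assert (Hlo : 0 < lam_lo) by (unfold lam_lo; lra).
  rewrite cfun_eq by exact Hlo.
  apply Rle_div_l; [apply Psi_pos, Hlo |].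
  assert (HP := Psi_approx lam_lo ltac:(unfold lam_lo, lam_hi; lra)).
  apply Rabs_le_between in HP.
  assert (1.06925259 <= Psi_poly lam_lo) by (unfold Psi_poly, lam_lo; lra).
  assert (HE := exp_lo_bounds). lra.
Qed.

(** Bounding exp at the left end and Psi at the right end of the enclosure loses
    only a relative 10^-8. *)
Lemma cfun_ge (l : R) : lam_lo <= l <= lam_hi -> 3.824963 <= cfun l.
Proof.
  intros Hl.
  assert (Hlo : 0 < lam_lo) by (unfold lam_lo; lra).
  rewrite cfun_eq by lra.
  apply (Rle_div_r _ _ (Psi l)); [apply Psi_pos; lra |].
  assert (HP := Psi_approx l ltac:(lra)).
  apply Rabs_le_between in HP.
  assert (HM : Psi_poly l <= Psi_poly lam_hi).
  { assert (Hn : forall n, l ^ n <= lam_hi ^ n) by (intros n; apply pow_incr; lra).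
    generalize (Hn 2%nat) (Hn 4%nat) (Hn 6%nat) (Hn 10%nat) (Hn 12%nat).
    unfold Psi_poly. lra. }
  assert (Psi_poly lam_hi <= 1.069252611) by (unfold Psi_poly, lam_hi; lra).
  assert (HE := exp_lo_bounds).
  assert (exp lam_lo <= exp l).
  { destruct (proj1 Hl) as [H1 | H1]; [left; apply exp_increasing, H1 | rewrite H1; lra]. }
  lra.
Qed.

Lemma minimizer_strict (l y : R) :
  lam_lo <= l <= lam_hi -> slope l = 0 -> 0 < y -> y <> l -> cfun l < cfun y.
Proof.
  intros Hl H0 Hy Hne.
  assert (Hb : 0 < lam_lo <= lam_hi /\ lam_hi <= 4) by (unfold lam_lo, lam_hi; lra).
  destruct (Rle_lt_dec y 4) as [H4 | H4].
  - apply cfun_slope_lt; lra.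
  - assert (cfun l <= cfun lam_lo).
    { destruct (Req_dec l lam_lo) as [-> | Hn]; [lra |].
      left. apply cfun_slope_lt; lra. }
    assert (H1 := cfun_lo_le). assert (H2 := cfun_ge_id y Hy). lra.
Qed.

Lemma approx_decimals_intro (k : nat) (x : R) (z : Z) :
  IZR z - / 2 <= x * 10 ^ k < IZR z + / 2 -> approx_decimals k x (IZR z / 10 ^ k).
Proof.
  intros H. unfold approx_decimals, round_decimals.
  rewrite <- (Int_part_spec _ z); [reflexivity | lra].
Qed.

Lemma fixed_point_iff (c rho : R) :
  0 < c -> 0 < rho -> (rho = Qfun (c * rho) <-> cfun (c * rho) = c).
Proof.
  intros Hc Hr.
  assert (Hm : 0 < c * rho) by (apply Rmult_lt_0_compat; assumption).
  assert (HQ := Qfun_pos _ Hm). unfold cfun.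
  split; intros H.
  - rewrite <- H. field. lra.
  - apply Rmult_eq_reg_l with c; [| lra]. rewrite <- H at 2. field. lra.
Qed.

(** The intermediate value theorem is applied to exp - c Psi, which unlike c(x)
    is continuous on the whole line. *)
Lemma cfun_surjective_above (l c : R) :
  0 < l -> cfun l <= c -> exists x : R, 0 < x /\ cfun x = c.
Proof.
  intros Hl Hlc.
  assert (Hlc' : l <= c) by (eapply Rle_trans; [apply cfun_ge_id, Hl | exact Hlc]).
  assert (HPl := Psi_pos l Hl). assert (HPc := Psi_pos c ltac:(lra)).
  destruct (IVT_gen (fun x => exp x - c * Psi x) l c 0) as [x [Hx H0]].
  - apply continuity_minus; [apply derivable_continuous, derivable_exp |].
    apply continuity_scal, exp_dominated_continuity, psi_coeff_dominated.
  - assert (H1 : exp l <= c * Psi l).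
    { apply Rle_div_l; [exact HPl |]. rewrite <- cfun_eq; assumption. }
    assert (H2 : c * Psi c <= exp c).
    { apply Rle_div_r; [exact HPc |]. rewrite <- cfun_eq by lra. apply cfun_ge_id. lra. }
    rewrite Rmin_left, Rmax_right; lra.
  - rewrite Rmin_left, Rmax_right in Hx by exact Hlc'.
    exists x. split; [lra |]. rewrite cfun_eq by lra.
    assert (HPx := Psi_pos x ltac:(lra)).
    replace (exp x) with (c * Psi x) by lra. field. lra.
Qed.

Theorem theorem18 :
  exists lstar : R,
    unique (global_minimizer_on (fun x : R => 0 < x) cfun) lstar /\
    approx_decimals 6 lstar 1.408509 /\
    approx_decimals 6 (Qfun lstar) 0.368241 /\
    approx_decimals 6 (cfun lstar) 3.824963 /\
    (forall c : R, 0 < c ->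
       ((exists rho : R, 0 < rho /\ rho = Qfun (c * rho)) <-> cfun lstar <= c)).
Proof.
  destruct slope_root as [l [Hl H0]].
  assert (Hl' : 1.40850872 <= l <= 1.40850873) by exact Hl.
  assert (Hstrict := minimizer_strict l).
  assert (Hmin : forall y, 0 < y -> cfun l <= cfun y).
  { intros y Hy. destruct (Req_dec y l) as [-> | Hne]; [lra |]. left. auto. }
  assert (Hc1 := cfun_ge l Hl).
  assert (Hc2 : cfun l <= 3.8249632).
  { apply Rle_trans with (cfun lam_lo); [apply Hmin; unfold lam_lo; lra | exact cfun_lo_le]. }
  exists l. split; [| split; [| split; [| split]]].
  - split.
    + split; [lra | exact Hmin].
    + intros y [Hy Hymin].
      destruct (Req_dec y l) as [-> | Hne]; [reflexivity | exfalso].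
      assert (H1 := Hstrict y Hl H0 Hy Hne). assert (H2 := Hymin l ltac:(lra)). lra.
  - replace 1.408509 with (IZR 1408509 / 10 ^ 6) by lra.
    apply approx_decimals_intro. lra.
  - replace 0.368241 with (IZR 368241 / 10 ^ 6) by lra.
    apply approx_decimals_intro.
    assert (HQ := Qfun_pos l ltac:(lra)).
    assert (HcQ : cfun l * Qfun l = l) by (unfold cfun; field; lra).
    nra.
  - replace 3.824963 with (IZR 3824963 / 10 ^ 6) by lra.
    apply approx_decimals_intro. lra.
  - intros c Hc. split.
    + intros [rho [Hr H]]. rewrite (fixed_point_iff c rho Hc Hr) in H.
      apply Rle_trans with (cfun (c * rho)); [| lra].
      apply Hmin, Rmult_lt_0_compat; assumption.
    + intros H. destruct (cfun_surjective_above l c) as [x [Hx Hcx]]; [lra | exact H |].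
      exists (x / c). assert (Hr : 0 < x / c) by (apply Rdiv_lt_0_compat; assumption).
      split; [exact Hr |]. apply fixed_point_iff; [exact Hc | exact Hr |].
      replace (c * (x / c)) with x by (field; lra). exact Hcx.
Qed.
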